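(* Let $X$ be a Bishop-locally compact metric space, let $M=\mathcal{M}(X)$ be its localic completion, with set of basic opens $S$, and let $O\subseteq S$. If the closed sublocale $M\setminus O$ is overt, then $M\setminus O$ is (formally) located. Consequently, the set of points $Y=j^{-1}[\mathrm{Pt}(M\setminus O)]\subseteq X$ is located as a subset of $X$, and moreover $O_*$ (viewed as a subset of $X$ via $j$) is the metric complement of $Y$ in $X$.
   Context: The setting is Bishop-style constructive mathematics (intuitionistic logic) with the axiom of dependent choice. Real numbers are Dedekind reals. Finite sets: a set is finite if it is in bijective correspondence with a set $\{0,\dots,n\}$, $n\ge 0$, and K-finite if it is the image of a finite set. A metric space is Bishop-locally compact if it is complete and locally totally bounded, i.e. for each ball and each $\varepsilon>0$ the ball can be covered by a K-finite set of balls of radius at most $\varepsilon$. A subset $A$ of a metric space $(X,d)$ is located if for each $x\in X$ the distance $d(x,A)=\inf\{d(x,a)\mid a\in A\}$ exists as a (Dedekind) real number. The metric complement of $Y$ in $X$ is $\{x\in X\mid d(x,Y)>0\}$. Formal topology: a preorder $(S,\leqslant)$ of basic opens with a relation $\vartriangleleft$ between elements and subsets of $S$ satisfying: (Ref) $a\in U$ implies $a\vartriangleleft U$; (Tra) $a\vartriangleleft U$ and $U\vartriangleleft V$ imply $a\vartriangleleft V$, where $U\vartriangleleft V$ means $u\vartriangleleft V$ for all $u\in U$; (Loc) $a\vartriangleleft U$ and $a\vartriangleleft V$ imply $a\vartriangleleft\{x\mid \exists u\in U\,\exists v\in V.\ x\leqslant u,\ x\leqslant v\}$; (Ext) $a\leqslant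 b$ implies $a\vartriangleleft\{b\}$. Points: a point of $(S,\vartriangleleft)$ is an inhabited subset $\alpha\subseteq S$ that is filtering with respect to $\leqslant$ and such that $U\cap\alpha$ is inhabited whenever $a\vartriangleleft U$ for some $a\in\alpha$. $\mathrm{Pt}$ denotes the collection of points. For $U\subseteq S$, $U_*$ is the class of points $\alpha$ such that $\alpha\cap U$ is inhabited. Closed sublocale: for $O\subseteq S$, the closed sublocale defined by the open $O$, written $M\setminus O$ for $M=(S,\vartriangleleft)$, is the formal topology on the same preorder with cover $u\vartriangleleft_{-O}V$ iff $u\vartriangleleft V\cup O$. Overt: a formal topology is overt if it carries a positivity predicate, i.e. a predicate $\mathrm{Pos}$ on $S$ with (Pos) $U\vartriangleleft\{u\in U\mid \mathrm{Pos}(u)\}$ for all $U\subseteq S$; (Mon) if $\mathrm{Pos}(u)$ and $u\vartriangleleft V$ then $\mathrm{Pos}(v)$ for some $v\in V$. (For $M\setminus O$ these conditions and the notion of point refer to the cover $\vartriangleleft_{-O}$.) Localic completion $\mathcal{M}(X)$ of a metric space $(X,d)$: basic opens are pairs $(x,r)\in X\times\mathbb{Q}^{>0}$, written $\mathsf{b}(x,r)$. Put $\mathsf{b}(x,r)<\mathsf{b}(y,s)$ iff $d(x,y)<s-r$, and $\mathsf{b}(x,r)\leqslant\mathsf{b}(y,s)$ iff $d(x,y)<t$ for all $t>s-r$. The cover $\vartriangleleft$ is the formal topology cover inductively generated by (M1) $u\vartriangleleft\{v\mid v<u\}$ and (M2) $u\vartriangleleft\{\mathsf{b}(x,r)\mid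 x\in X\}$ for every basic open $u$ and every rational $r>0$. For $X$ complete, $j:X\to\mathrm{Pt}(\mathcal{M}(X))$, $j(x)=\{\mathsf{b}(y,r)\mid d(x,y)<r\}$, is a metric isomorphism. Formally located: a predicate $\mathrm{Pos}$ on the basic opens $S$ of $\mathcal{M}(X)$ is called located if (i) $\mathrm{Pos}(u)$ and $u\vartriangleleft V$ imply $\mathrm{Pos}(v)$ for some $v\in V$; (ii) $v<u$ implies $\neg\mathrm{Pos}(v)$ or $\mathrm{Pos}(u)$. A closed sublocale $T$ of $\mathcal{M}(X)$ is (formally) located if there is a located predicate $\mathrm{Pos}$ such that $T$ coincides with the closed sublocale defined by the open $\{u\in S\mid\neg\mathrm{Pos}(u)\}$.
   Formalization: Y can be empty (e.g. O = S), and then d(x,Y) is not a real number; so d(x,Y) may be +∞ in ''located'' and in ''metric complement'', and Y is claimed located with real-valued distances only when Y is inhabited. *)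

(* Defs.v *)
(* The setting is intuitionistic: every definition below is to be read as
   stated, without excluded middle, and nothing here depends on an axiom. *)
From Stdlib Require Import RelationClasses.
From mathcomp Require Import all_boot all_order all_algebra.
From mathcomp Require Import lra.

Set Implicit Arguments.
Unset Strict Implicit.
Unset Printing Implicit Defensive.

Import Order.TTheory GRing.Theory Num.Theory.
Local Open Scope ring_scope.

Definition dependent_choice : Prop :=
  forall (A : Type) (R : A -> A -> Prop), (forall a, exists b, R a b) ->
  forall a0, exists f : nat -> A, f 0%N = a0 /\ forall n, R (f n) (f n.+1).

(** * Dedekind reals *)

(* Two-sided cuts whose upper part may be empty: the Dedekind reals together
   with +oo.  The value +oo is needed only for the distance to a subset that is
   not known to be inhabited (inf of the empty set). *)
Record xreal := XReal {
  lower : rat -> Prop;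
  upper : rat -> Prop;
  lower_inhabited : exists q, lower q;
  lower_rounded : forall q, lower q <-> exists r, q < r /\ lower r;
  upper_rounded : forall q, upper q <-> exists r, r < q /\ upper r;
  cut_disjoint : forall q, ~ (lower q /\ upper q);
  cut_located : forall q r, q < r -> lower q \/ upper r }.

Record dreal := DReal {
  dreal_cut :> xreal;
  upper_inhabited : exists q, upper dreal_cut q }.

Declare Scope dreal_scope.
Delimit Scope dreal_scope with D.
Bind Scope dreal_scope with xreal.
Bind Scope dreal_scope with dreal.

Definition xlt (x y : xreal) : Prop := exists q, upper x q /\ lower y q.
Definition xle (x y : xreal) : Prop := ~ xlt y x.
Definition xeq (x y : xreal) : Prop := xle x y /\ xle y x.

Notation "x < y" := (xlt x y) : dreal_scope.
Notation "x <= y" := (xle x y) : dreal_scope.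
Notation "x == y" := (xeq x y) : dreal_scope.

Lemma lower_down (x : xreal) (p q : rat) : p < q -> lower x q -> lower x p.
Proof. by move=> pq xq; apply/lower_rounded; exists q. Qed.

Lemma upper_up (x : xreal) (p q : rat) : p < q -> upper x p -> upper x q.
Proof. by move=> pq xp; apply/upper_rounded; exists p. Qed.

Lemma lower_lt_upper (x : xreal) (p q : rat) : lower x p -> upper x q -> p < q.
Proof.
move=> xp xq; case: (ltgtP p q) => // [qp|pq].
- by case: (@cut_disjoint x q); split=> //; apply: lower_down xp.
- by case: (@cut_disjoint x q); split=> //; rewrite -pq.
Qed.

Lemma dreal_approx (x : dreal) (e : rat) :
  0 < e -> exists p, lower x p /\ upper x (p + e).
Proof.
move=> e0; case: (lower_inhabited x) => a xa; case: (upper_inhabited x) => b xb.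
pose h := e / 2; have h0 : 0 < h by rewrite /h; lra.
have [n xn] : exists n : nat, upper x (a + n%:R * h).
  have ab : a < b by exact: lower_lt_upper xa xb.
  have bh0 : 0 <= (b - a) / h by rewrite divr_ge0 ?ltW // subr_gt0.
  exists (Num.bound ((b - a) / h)); apply: upper_up xb.
  by have := archi_boundP bh0; rewrite ltr_pdivrMr // ltrBlDl.
elim: n a xa xn => [|n IHn] a xa xn.
  by case: (@cut_disjoint x a); split=> //; rewrite mul0r addr0 in xn.
have ah : a + h < a + e by rewrite /h; lra.
case: (cut_located x ah) => [xah|xae]; last by exists a.
apply: (IHn (a + h)) => //.
rewrite (_ : a + h + n%:R * h = a + n.+1%:R * h) // -nat1r.
by rewrite mulrDl mul1r addrA.
Qed.

Section RatDreal.
Variable p : rat.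

Fact rat_lower_inhabited : exists q, q < p.
Proof. by exists (p - 1); lra. Qed.

Fact rat_upper_inhabited : exists q, p < q.
Proof. by exists (p + 1); lra. Qed.

Fact rat_lower_rounded q : q < p <-> exists r, q < r /\ r < p.
Proof.
split=> [qp|[r [qr rp]]]; last exact: lt_trans rp.
by exists ((q + p) / 2); split; lra.
Qed.

Fact rat_upper_rounded q : p < q <-> exists r, r < q /\ p < r.
Proof.
split=> [pq|[r [rq pr]]]; last exact: lt_trans rq.
by exists ((q + p) / 2); split; lra.
Qed.

Fact rat_cut_disjoint q : ~ (q < p /\ p < q).
Proof. by case=> qp pq; have := lt_trans qp pq; rewrite ltxx. Qed.

Fact rat_cut_located q r : q < r -> q < p \/ p < r.
Proof. by move=> qr; case: (ltP q p) => [|pq]; [left|right; apply: le_lt_trans qr]. Qed.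

Definition rat_dreal : dreal :=
  DReal (dreal_cut := XReal rat_lower_inhabited rat_lower_rounded
                        rat_upper_rounded rat_cut_disjoint rat_cut_located)
    rat_upper_inhabited.

End RatDreal.

Notation "q %:D" := (rat_dreal q) (at level 2, left associativity,
  format "q %:D") : dreal_scope.

Section AddDreal.
Variables x y : dreal.

Let add_lower (q : rat) := exists a b, [/\ lower x a, lower y b & q = a + b].
Let add_upper (q : rat) := exists a b, [/\ upper x a, upper y b & q = a + b].

Fact add_lower_inhabited : exists q, add_lower q.
Proof.
case: (lower_inhabited x) (lower_inhabited y) => a xa [b yb].
by exists (a + b), a, b.
Qed.

Fact add_upper_inhabited : exists q, add_upper q.
Proof.
case: (upper_inhabited x) (upper_inhabited y) => a xa [b yb].
by exists (a + b), a, b.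
Qed.

Fact add_lower_rounded q : add_lower q <-> exists r, q < r /\ add_lower r.
Proof.
split=> [[a [b [xa yb ->]]]|[r [qr [a [b [xa yb rE]]]]]]; last first.
  by exists (q - b), b; split; [apply: lower_down xa; lra | | lra].
have [a' [aa' xa']] := (lower_rounded x a).1 xa.
by exists (a' + b); split; [lra | exists a', b].
Qed.

Fact add_upper_rounded q : add_upper q <-> exists r, r < q /\ add_upper r.
Proof.
split=> [[a [b [xa yb ->]]]|[r [qr [a [b [xa yb rE]]]]]]; last first.
  by exists (q - b), b; split; [apply: upper_up xa; lra | | lra].
have [a' [aa' xa']] := (upper_rounded x a).1 xa.
by exists (a' + b); split; [lra | exists a', b].
Qed.

Fact add_cut_disjoint q : ~ (add_lower q /\ add_upper q).
Proof.
case=> -[a [b [xa yb ->]]] [a' [b' [xa' yb' E]]].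
by have := lower_lt_upper xa xa'; have := lower_lt_upper yb yb'; lra.
Qed.

Fact add_cut_located q r : q < r -> add_lower q \/ add_upper r.
Proof.
move=> qr; have e0 : 0 < (r - q) / 2 by lra.
have [a [xa xae]] := dreal_approx x e0.
have [b [yb ybe]] := dreal_approx y e0.
case: (ltP q (a + b)) => qab; [left|right].
  by apply/add_lower_rounded; exists (a + b); split=> //; exists a, b.
have [a' [aa' xa']] := (upper_rounded x _).1 xae.
apply/add_upper_rounded; exists (a' + (b + (r - q) / 2)); split; first lra.
by exists a', (b + (r - q) / 2).
Qed.

Definition dreal_add : dreal :=
  DReal (dreal_cut := XReal add_lower_inhabited add_lower_rounded
                        add_upper_rounded add_cut_disjoint add_cut_located)
    add_upper_inhabited.

End AddDreal.

Notation "x + y" := (dreal_add x y) : dreal_scope.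

Lemma xlt_ratE (x : xreal) (q : rat) : (x < q%:D)%D <-> upper x q.
Proof.
split=> [[p [xp pq]]|/upper_rounded[r [rq xr]]]; first exact: upper_up xp.
by exists r.
Qed.

Lemma xle_upper (x y : xreal) (q : rat) : (x <= y)%D -> upper y q -> upper x q.
Proof.
move=> xy /upper_rounded[r [rq yr]].
by case: (cut_located x rq) => // xr; case: xy; exists r.
Qed.

(** The infimum in the strong (constructive) sense. *)
Definition is_inf (A : xreal -> Prop) (m : xreal) : Prop :=
  (forall a, A a -> (m <= a)%D) /\
  (forall b : xreal, (m < b)%D -> exists a, A a /\ (a < b)%D).

(** * Metric spaces *)

(* A Bishop set is a type together with its own equality. *)
Record metric_space := MetricSpace {
  carrier :> Type;
  ms_eq : carrier -> carrier -> Prop;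
  dist : carrier -> carrier -> dreal;
  ms_eq_equiv : Equivalence ms_eq;
  dist_ge0 : forall x y, (0%:D <= dist x y)%D;
  dist_eq0 : forall x y, (dist x y == 0%:D)%D <-> ms_eq x y;
  dist_sym : forall x y, (dist x y == dist y x)%D;
  dist_triangle : forall x y z, (dist x z <= dist x y + dist y z)%D }.

Definition cauchy (X : metric_space) (s : nat -> X) : Prop :=
  forall e : rat, 0 < e -> exists N : nat, forall m n : nat,
    (N <= m)%N -> (N <= n)%N -> (dist (s m) (s n) < e%:D)%D.

Definition converges (X : metric_space) (s : nat -> X) (x : X) : Prop :=
  forall e : rat, 0 < e -> exists N : nat, forall n : nat,
    (N <= n)%N -> (dist (s n) x < e%:D)%D.

Definition complete (X : metric_space) : Prop :=
  forall s : nat -> X, cauchy s -> exists x, converges s x.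

Definition k_finite (T : Type) (F : T -> Prop) : Prop :=
  exists (n : nat) (f : 'I_n.+1 -> T), forall t, F t <-> exists i, t = f i.

(* The pairs (x, r), serving both as names of metric balls and as the basic
   opens of the localic completion. *)
Record basic_open (X : metric_space) := B {
  center : X;
  radius : rat;
  radius_gt0 : 0 < radius }.

Definition in_ball (X : metric_space) (u : basic_open X) (y : X) : Prop :=
  (dist y (center u) < (radius u)%:D)%D.

Definition locally_totally_bounded (X : metric_space) : Prop :=
  forall (u : basic_open X) (e : rat), 0 < e ->
  exists F : basic_open X -> Prop, k_finite F /\
    (forall v, F v -> radius v <= e) /\
    (forall y, in_ball u y -> exists v, F v /\ in_ball v y).

Definition bishop_locally_compact (X : metric_space) : Prop :=
  complete X /\ locally_totally_bounded X.

Definition distances (X : metric_space) (A : X -> Prop) (x : X) : xreal -> Prop :=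
  fun t => exists a, A a /\ t = dist x a.

Definition located (X : metric_space) (A : X -> Prop) : Prop :=
  forall x : X, exists m : dreal, is_inf (distances A x) m.

(* As [located], with d(x, A) = +oo allowed; for an inhabited A this is the
   same as [located]. *)
Definition xlocated (X : metric_space) (A : X -> Prop) : Prop :=
  forall x : X, exists m : xreal, is_inf (distances A x) m.

(* d(x, A) > 0, where d(x, A) may be +oo; thus the metric complement of the
   empty set is X. *)
Definition metric_complement (X : metric_space) (A : X -> Prop) : X -> Prop :=
  fun x => exists m : xreal, is_inf (distances A x) m /\ (0%:D < m)%D.

(** * Formal topologies *)

Record preorder := Preorder {
  opens :> Type;
  ple : opens -> opens -> Prop;
  ple_refl : forall a, ple a a;
  ple_trans : forall a b c, ple a b -> ple b c -> ple a c }.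

Definition down_meet (S : preorder) (U V : S -> Prop) : S -> Prop :=
  fun x => exists u v, [/\ U u, V v, ple x u & ple x v].

Record formal_topology (S : preorder) := FormalTopology {
  cov :> S -> (S -> Prop) -> Prop;
  cov_ref : forall a (U : S -> Prop), U a -> cov a U;
  cov_tra : forall a (U V : S -> Prop),
    cov a U -> (forall u, U u -> cov u V) -> cov a V;
  cov_loc : forall a (U V : S -> Prop),
    cov a U -> cov a V -> cov a (down_meet U V);
  cov_ext : forall a b : S, ple a b -> cov a (fun x => x = b) }.

Definition is_point (S : preorder) (T : formal_topology S) (al : S -> Prop) : Prop :=
  [/\ exists a, al a,
      forall a b, al a -> al b -> exists c, [/\ al c, ple c a & ple c b]
    & forall a (U : S -> Prop), al a -> T a U -> exists u, U u /\ al u].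

(** The class U_* of points. *)
Definition points_of (S : preorder) (T : formal_topology S) (U : S -> Prop) :
    (S -> Prop) -> Prop :=
  fun al => is_point T al /\ exists u, al u /\ U u.

Definition positivity (S : preorder) (T : formal_topology S) (Pos : S -> Prop) : Prop :=
  (forall (U : S -> Prop) u, U u -> T u (fun v => U v /\ Pos v)) /\
  (forall u (V : S -> Prop), Pos u -> T u V -> exists v, V v /\ Pos v).

Definition overt (S : preorder) (T : formal_topology S) : Prop :=
  exists Pos : S -> Prop, positivity T Pos.

Definition same_topology (S : preorder) (T1 T2 : formal_topology S) : Prop :=
  forall a (U : S -> Prop), T1 a U <-> T2 a U.

Section ClosedSublocale.
Variables (S : preorder) (M : formal_topology S) (O : S -> Prop).

Definition closed_cov (u : S) (V : S -> Prop) : Prop := M u (fun v => V v \/ O v).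

Fact closed_cov_ref a (U : S -> Prop) : U a -> closed_cov a U.
Proof. by move=> Ua; apply: cov_ref; left. Qed.

Fact closed_cov_tra a (U V : S -> Prop) :
  closed_cov a U -> (forall u, U u -> closed_cov u V) -> closed_cov a V.
Proof.
move=> aU UV; apply: cov_tra aU _ => u [/UV//|Ou].
by apply: cov_ref; right.
Qed.

Fact closed_cov_loc a (U V : S -> Prop) :
  closed_cov a U -> closed_cov a V -> closed_cov a (down_meet U V).
Proof.
move=> aU aV; apply: cov_tra (cov_loc aU aV) _ => x [u [v [Uu Vv xu xv]]].
case: Uu => [Uu|Ou]; last first.
  by apply: cov_tra (cov_ext M xu) _ => _ ->; apply: cov_ref; right.
case: Vv => [Vv|Ov]; last first.
  by apply: cov_tra (cov_ext M xv) _ => _ ->; apply: cov_ref; right.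
by apply: cov_ref; left; exists u, v.
Qed.

Fact closed_cov_ext (a b : S) : ple a b -> closed_cov a (fun x => x = b).
Proof.
move=> ab; apply: cov_tra (cov_ext M ab) _ => _ ->.
by apply: cov_ref; left.
Qed.

(** [closed_sublocale M O] is M \ O. *)
Definition closed_sublocale : formal_topology S :=
  FormalTopology closed_cov_ref closed_cov_tra closed_cov_loc closed_cov_ext.

End ClosedSublocale.

(** * The localic completion *)

Section LocalicCompletion.
Variable X : metric_space.

Definition ball_lt (u v : basic_open X) : Prop :=
  (dist (center u) (center v) < (radius v - radius u)%:D)%D.

Definition ball_le (u v : basic_open X) : Prop :=
  forall t : rat, radius v - radius u < t -> (dist (center u) (center v) < t%:D)%D.

Fact ball_le_refl u : ball_le u u.
Proof.
move=> t; rewrite subrr => t0; apply/xlt_ratE.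
have [le0 _] := (dist_eq0 (center u) (center u)).2
  (@Equivalence_Reflexive _ _ (ms_eq_equiv X) _).
exact: xle_upper le0 _.
Qed.

Fact ball_le_trans u v w : ball_le u v -> ball_le v w -> ball_le u w.
Proof.
move=> uv vw t ht; pose e := (t - (radius w - radius u)) / 2.
have /uv/xlt_ratE duv : radius v - radius u < radius v - radius u + e.
  by rewrite /e; lra.
have /vw/xlt_ratE dvw : radius w - radius v < radius w - radius v + e.
  by rewrite /e; lra.
apply/xlt_ratE; have tri := @dist_triangle X (center u) (center v) (center w).
apply: (xle_upper tri).
by exists (radius v - radius u + e), (radius w - radius v + e); split=> //; rewrite /e; lra.
Qed.

Definition balls : preorder := Preorder ball_le_refl ball_le_trans.

Inductive ball_cov : balls -> (balls -> Prop) -> Prop :=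
| ball_cov_ref a (U : balls -> Prop) : U a -> ball_cov a U
| ball_cov_tra a (U V : balls -> Prop) :
    ball_cov a U -> (forall u, U u -> ball_cov u V) -> ball_cov a V
| ball_cov_loc a (U V : balls -> Prop) :
    ball_cov a U -> ball_cov a V -> ball_cov a (down_meet U V)
| ball_cov_ext (a b : balls) : ple a b -> ball_cov a (fun x => x = b)
| ball_cov_M1 u : ball_cov u (fun v => ball_lt v u)
| ball_cov_M2 u (r : rat) : 0 < r -> ball_cov u (fun v => radius v = r).

Definition localic_completion : formal_topology balls :=
  FormalTopology ball_cov_ref ball_cov_tra ball_cov_loc ball_cov_ext.

(** The map j, a point being represented by its underlying subset. *)
Definition j (x : X) : balls -> Prop := fun u => in_ball u x.

Definition located_predicate (Pos : balls -> Prop) : Prop :=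
  (forall u (V : balls -> Prop),
     Pos u -> localic_completion u V -> exists v, V v /\ Pos v) /\
  (forall u v : balls, ball_lt v u -> ~ Pos v \/ Pos u).

Definition formally_located (T : formal_topology balls) : Prop :=
  exists Pos : balls -> Prop, located_predicate Pos /\
    same_topology T (closed_sublocale localic_completion (fun u => ~ Pos u)).

End LocalicCompletion.

(* Main.v *)
(** Every cover in the localic completion of a locally totally bounded space
    is uniform: if [u] is covered by [W] and [v < u], all sufficiently small
    balls [b < v] satisfy [b < w] for some [w] in [W].  Applied to the cover of
    [u] by [{u | Pos u}] and [O], a finite net of [v] then decides [Pos u] or
    "[v] is covered by [O]", which is locatedness of the positivity predicate.
    A positive ball contains a point of [Y], the limit of a sequence of
    shrinking positive balls; hence [d(x, Y)] is the cut separating the [r]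
    with [~ Pos (x, r)] from those with [Pos (x, r)]. *)
From Stdlib Require Import RelationClasses.
From mathcomp Require Import all_boot all_order all_algebra.
From mathcomp Require Import lra.
Require Import Defs.

Set Implicit Arguments.
Unset Strict Implicit.
Unset Printing Implicit Defensive.

Import Order.TTheory GRing.Theory Num.Theory.
Local Open Scope ring_scope.

(** * Decisions and common bounds over finite index sets *)

(** Finiteness of the index set makes this distribution constructive: the alternatives are inspected
    one by one. *)
Lemma fin_or (n : nat) (A : Prop) (B : 'I_n -> Prop) :
  (forall i, A \/ B i) -> A \/ forall i, B i.
Proof.
elim: n B => [|n IHn] B AB; first by right; case.
case: (AB ord0) => [|B0]; first by left.
case: (IHn (fun i => B (lift ord0 i))) => [i|a|B1]; [exact: AB|by left|right].
by move=> i; case: (unliftP ord0 i) => [k ->|->].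
Qed.

Lemma fin_common_bound (n : nat) (Q : 'I_n -> rat -> Prop) :
  (forall i e e', e' <= e -> Q i e -> Q i e') ->
  (forall i, exists e, 0 < e /\ Q i e) ->
  exists e, 0 < e /\ forall i, Q i e.
Proof.
elim: n Q => [|n IHn] Q Qle Qe; first by exists 1; split=> //; case.
have [e0 [e0_gt0 Qe0]] := Qe ord0.
have [i a b|i|e1 [e1_gt0 Qe1]] := IHn (fun i => Q (lift ord0 i)).
- exact: Qle.
- exact: Qe.
exists (Num.min e0 e1); split; first by rewrite lt_min e0_gt0.
move=> i; case: (unliftP ord0 i) => [k ->|->].
- by apply: Qle (Qe1 k); rewrite ge_min lexx orbT.
- by apply: Qle Qe0; rewrite ge_min lexx.
Qed.

Lemma exists_half_pow_lt (a e : rat) :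
  0 < a -> 0 < e -> exists n : nat, a / 2 ^+ n < e.
Proof.
move=> a0 e0; exists (Num.bound (a / e)).
have /archi_boundP : 0 <= a / e by rewrite divr_ge0 ?ltW.
set n := Num.bound _; rewrite ltr_pdivrMr // => ane.
rewrite ltr_pdivrMr ?exprn_gt0 // mulrC; apply: lt_trans ane _.
by rewrite ltr_pM2r // -natrX ltr_nat ltn_expl.
Qed.

(** * Balls, finite nets and uniform covers *)

Section Balls.
Variable X : metric_space.
Implicit Types (x y z : X) (u v w b c : balls X).

Lemma dist_upper_le x y (p q : rat) :
  p <= q -> upper (dist x y) p -> upper (dist x y) q.
Proof. by rewrite le_eqVlt => /orP[/eqP->//|]; exact: upper_up. Qed.

Lemma dist_refl_upper x (q : rat) : 0 < q -> upper (dist x x) q.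
Proof.
move=> q0; apply: xle_upper (q0 : upper 0%:D q).
by have [] := (dist_eq0 x x).2 (@Equivalence_Reflexive _ _ (ms_eq_equiv X) x).
Qed.

Lemma dist_sym_upper x y (q : rat) : upper (dist x y) q -> upper (dist y x) q.
Proof. by apply: xle_upper; have [] := dist_sym x y. Qed.

Lemma dist_triangle_upper x y z (p q : rat) :
  upper (dist x y) p -> upper (dist y z) q -> upper (dist x z) (p + q).
Proof.
by move=> xyp yzq; apply: xle_upper (@dist_triangle X x y z) _; exists p, q.
Qed.

Lemma dist_upper_gt0 x y (q : rat) : upper (dist x y) q -> 0 < q.
Proof. exact: (xle_upper (@dist_ge0 X x y)). Qed.

Lemma in_ballE u x : in_ball u x <-> upper (dist x (center u)) (radius u).
Proof. exact: xlt_ratE. Qed.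

Lemma ball_ltE u v :
  ball_lt u v <-> upper (dist (center u) (center v)) (radius v - radius u).
Proof. exact: xlt_ratE. Qed.

Lemma ball_lt_le u v : ball_lt u v -> ball_le u v.
Proof. by move=> /ball_ltE uv t ht; apply/xlt_ratE; exact: upper_up uv. Qed.

Lemma ball_le_radius u v : ball_le u v -> radius u <= radius v.
Proof.
move=> uv; rewrite leNgt; apply/negP => vu.
have /uv/xlt_ratE/dist_upper_gt0 : radius v - radius u < 0 by lra.
by rewrite ltxx.
Qed.

Lemma ball_lt_radius u v : ball_lt u v -> radius u < radius v.
Proof. by move=> /ball_ltE/dist_upper_gt0; lra. Qed.

Lemma ball_lt_le_trans u v w : ball_lt u v -> ball_le v w -> ball_lt u w.
Proof.
move=> /ball_ltE uv vw; apply/ball_ltE.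
have [p [hp cp]] := (upper_rounded _ _).1 uv.
have /vw/xlt_ratE cq : radius w - radius v < radius w - radius u - p by lra.
by have := dist_triangle_upper cp cq; apply: dist_upper_le; lra.
Qed.

Lemma ball_lt_trans u v w : ball_lt u v -> ball_lt v w -> ball_lt u w.
Proof. by move=> uv /ball_lt_le; exact: ball_lt_le_trans. Qed.

Lemma ball_lt_center u v : ball_lt u v -> in_ball v (center u).
Proof.
move=> /ball_ltE uv; apply/in_ballE; apply: dist_upper_le uv.
by have := radius_gt0 u; lra.
Qed.

Lemma concentric_ball_lt x (r s : rat) (r0 : 0 < r) (s0 : 0 < s) :
  r < s -> ball_lt (B x r0) (B x s0).
Proof. by move=> rs; apply/ball_ltE/dist_refl_upper => /=; lra. Qed.

Lemma ball_lt_dense u v : ball_lt u v -> exists w, ball_lt u w /\ ball_lt w v.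
Proof.
move=> /ball_ltE uv; have [p [hp cp]] := (upper_rounded _ _).1 uv.
have p0 := dist_upper_gt0 cp; have u0 := radius_gt0 u.
(* The interpolant is concentric with [v]; roundedness of the cut puts its radius [p + radius u]
   strictly below [radius v]. *)
have w0 : 0 < p + radius u by lra.
exists (B (center v) w0); split; apply/ball_ltE => /=.
- by apply: dist_upper_le cp; lra.
- by apply: dist_refl_upper; lra.
Qed.

Lemma in_ball_centered u x : in_ball u x ->
  exists d : rat, 0 < d /\
    forall (r : rat) (r0 : 0 < r), r <= d -> ball_lt (B x r0) u.
Proof.
move=> /in_ballE xu; have [p [hp cp]] := (upper_rounded _ _).1 xu.
exists (radius u - p); split=> [|r r0 rd]; first by lra.
by apply/ball_ltE => /=; apply: dist_upper_le cp; lra.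
Qed.

Lemma ball_cov_small u (e : rat) :
  0 < e -> ball_cov u (fun v => ball_lt v u /\ radius v <= e).
Proof.
move=> e0.
apply: ball_cov_tra (ball_cov_loc (ball_cov_M1 u) (ball_cov_M2 u e0)) _.
(* (Loc) gives only [ball_le] below [w] and [z]; one more shrinking by (M1) restores strictness. *)
move=> v [w [z [wu ze vw vz]]]; apply: ball_cov_tra (ball_cov_M1 v) _ => c cv.
apply: ball_cov_ref; split.
- exact: ball_lt_trans (ball_lt_le_trans cv vw) wu.
- by rewrite -ze; apply: le_trans (ball_le_radius vz); exact/ltW/ball_lt_radius.
Qed.

(* The net may contain balls not known to lie in [u]; by the last clause those
   which do not meet no ball inside [v]. *)
Lemma finite_net (hX : locally_totally_bounded X) u v (e : rat) :
  ball_lt v u -> 0 < e ->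
  exists (n : nat) (g : 'I_n -> balls X) (d : rat),
  [/\ 0 < d, forall i, radius (g i) <= e,
      forall c, ball_lt c v -> radius c <= d -> exists i, ball_lt c (g i)
    & forall i, ball_lt (g i) u \/ forall c, ball_lt c v -> ~ ball_lt c (g i)].
Proof.
move=> /ball_ltE vu e0; have [p [hp cp]] := (upper_rounded _ _).1 vu.
(* [radius u - radius v - p] is the slack of [v] inside [u]; an eighth of it leaves room for net
   balls of radius [2 * d] and the test at [3 * d] below. *)
pose d := Num.min e (radius u - radius v - p) / 8.
have [d0 de du] : [/\ 0 < d, 8 * d <= e & 8 * d <= radius u - radius v - p].
  have -> : 8 * d = Num.min e (radius u - radius v - p) by rewrite /d; lra.
  by split; [rewrite divr_gt0 // lt_min e0; lra | rewrite ge_min lexx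
            | rewrite ge_min lexx orbT].
have [F [[n [f Ff]] [Fd Fv]]] := hX v d d0.
have dd0 : 0 < 2 * d by lra.
(* Covering balls have radius at most [d]; enlarged to [2 * d], they strictly contain every ball of
   radius at most [d] centred in them. *)
exists n.+1, (fun i => B (center (f i)) dd0), d; split=> //= [_|c cv cd|i].
- by lra.
- have [b [/Ff[i bi] /in_ballE cb]] := Fv _ (ball_lt_center cv).
  have /Fd bd : F b by apply/Ff; exists i.
  by exists i; apply/ball_ltE; rewrite /= -bi; apply: dist_upper_le cb; lra.
(* Locatedness of the distance decides: beyond [radius v + 2 * d] no ball fits inside both, and
   within [radius v + 3 * d] the net ball lies in [u]. *)
- have lt32 : radius v + 2 * d < radius v + 3 * d by lra.
  case: (cut_located (dist (center (f i)) (center v)) lt32) => [far|near].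
  + right=> c /ball_ltE cv /ball_ltE/= /dist_sym_upper ci.
    have := lower_lt_upper far (dist_triangle_upper ci cv).
    by have := radius_gt0 c; lra.
  + left; apply/ball_ltE => /=.
    by have := dist_triangle_upper near cp; apply: dist_upper_le; lra.
Qed.

(** Induction on the generation of the cover. Transitivity is the case that calls on a finite net:
    each net ball has its own bound, and finitely many bounds have a positive minimum. *)
Lemma ball_cov_uniform (hX : locally_totally_bounded X) u (W : balls X -> Prop) :
  ball_cov u W -> forall v, ball_lt v u ->
  exists e : rat, 0 < e /\ forall b, ball_lt b v -> radius b <= e ->
    exists w, W w /\ ball_lt b w.
Proof.
elim=> {u W} [a U Ua|a U V _ IHU _ IHV|a U V _ IHU _ IHV|a b ab|u|u r r0] v va.
- exists 1; split=> // b bv _; exists a; split=> //; exact: ball_lt_trans va.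
- have [v' [vv' v'a]] := ball_lt_dense va.
  have [e [e0 He]] := IHU _ v'a.
  have [n [g [d [d0 ge gc gnear]]]] := finite_net hX vv' e0.
  pose Q i (t : rat) := forall c, ball_lt c v -> ball_lt c (g i) ->
    radius c <= t -> exists w, V w /\ ball_lt c w.
  have [i t t' tt' Qt c cv ci ct|i|t [t0 Qt]] := @fin_common_bound _ Q.
  + by apply: Qt => //; exact: le_trans tt'.
  + case: (gnear i) => [gi|far].
      have [w [Uw gw]] := He _ gi (ge i).
      have [t [t0 Ht]] := IHV _ Uw _ gw.
      by exists t; split=> // c _; exact: Ht.
    (* No ball inside [v] lies in this net ball, so the bound 1 is arbitrary. *)
    by exists 1; split=> // c cv /(far _ cv).
  exists (Num.min d t); split; first by rewrite lt_min d0.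
  move=> b bv; rewrite le_min => /andP[bd bt].
  have [i bi] := gc _ bv bd; exact: Qt bi bt.
- have [e [e0 He]] := IHU _ va; have [t [t0 Ht]] := IHV _ va.
  exists (Num.min e t); split; first by rewrite lt_min e0.
  move=> b bv; rewrite le_min => /andP[be bt].
  have [w [Uw bw]] := He _ bv be; have [z [Vz bz]] := Ht _ bv bt.
  (* [b] itself is below [w] and [z], but a member strictly around [b] is wanted: enlarge [b]
     concentrically within the slack of both inclusions. *)
  have [d [d0 Hd]] : exists d, 0 < d /\ forall (r : rat) (r0 : 0 < r),
      r <= radius b + d -> ball_le (B (center b) r0) w /\ ball_le (B (center b) r0) z.
    have /ball_ltE/upper_rounded[p [hp cp]] := bw.
    have /ball_ltE/upper_rounded[q [hq cq]] := bz.
    exists (Num.min (radius w - radius b - p) (radius z - radius b - q)); split.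
      by rewrite lt_min; apply/andP; split; lra.
    move=> r r0; rewrite addrC -lerBlDr le_min => /andP[rp rq].
    split; apply: ball_lt_le; apply/ball_ltE => /=.
    + by apply: dist_upper_le cp; lra.
    + by apply: dist_upper_le cq; lra.
  have bd0 : 0 < radius b + d by have := radius_gt0 b; lra.
  have [xw xz] := Hd _ bd0 (lexx _).
  exists (B (center b) bd0); split; first by exists w, z.
  by apply/ball_ltE/dist_refl_upper => /=; lra.
- exists 1; split=> // c cv _; exists b; split=> //.
  exact: ball_lt_le_trans (ball_lt_trans cv va) ab.
- by exists 1; split=> // b bv _; exists v.
- exists (r / 2); split=> [|b _ br]; first by lra.
  exists (B (center b) r0); split=> //.
  by apply/ball_ltE/dist_refl_upper => /=; lra.
Qed.

(** By uniformity a small ball centred at [x] lies strictly inside a member of the cover, which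
    therefore contains [x]. *)
Lemma j_meets_cover (hX : locally_totally_bounded X) x u (W : balls X -> Prop) :
  in_ball u x -> ball_cov u W -> exists w, W w /\ in_ball w x.
Proof.
move=> xu uW; have [d [d0 Hd]] := in_ball_centered xu.
have [e [e0 He]] := ball_cov_uniform hX uW (Hd _ d0 (lexx _)).
pose t := Num.min d e / 2; have t0 : 0 < t by rewrite divr_gt0 // lt_min d0.
have tde : 2 * t = Num.min d e by rewrite /t; lra.
have [td te] : 2 * t <= d /\ 2 * t <= e by rewrite tde !ge_min !lexx orbT.
have [||w [Ww bw]] := He (B x t0); first by apply: concentric_ball_lt; lra.
  by rewrite /=; lra.
by exists w; split=> //; exact: (ball_lt_center bw).
Qed.

Lemma j_inhabited x : exists u, j x u.
Proof. by exists (B x ltr01); apply/in_ballE/dist_refl_upper. Qed.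

Lemma j_filtering x u v :
  j x u -> j x v -> exists w : balls X, [/\ j x w, ple w u & ple w v].
Proof.
move=> /in_ball_centered[d [d0 Hd]] /in_ball_centered[e [e0 He]].
have m0 : 0 < Num.min d e by rewrite lt_min d0.
exists (B x m0); split; first by apply/in_ballE/dist_refl_upper.
- by apply/ball_lt_le/Hd; rewrite ge_min lexx.
- by apply/ball_lt_le/He; rewrite ge_min lexx orbT.
Qed.

Lemma j_point (hX : locally_totally_bounded X) x :
  is_point (localic_completion X) (j x).
Proof.
split; [exact: j_inhabited|exact: j_filtering|move=> u W xu uW].
exact: j_meets_cover uW.
Qed.

End Balls.

(** * Positivity on a closed sublocale of any formal topology *)

Section OvertClosed.
Variables (S : preorder) (M : formal_topology S) (O Pos : S -> Prop).
Hypothesis PosP : positivity (closed_sublocale M O) Pos.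

Lemma positivity_mono u (V : S -> Prop) :
  Pos u -> M u V -> exists v, V v /\ Pos v.
Proof.
move=> Pu uV; apply: PosP.2 Pu _.
by apply: cov_tra uV _ => v Vv; apply: cov_ref; left.
Qed.

(** Being covered by [O] means being covered by the empty set in the closed sublocale, which (Mon)
    forbids for positive opens; conversely (Pos) for the singleton of [u] leaves only [O] when [u]
    is not positive. *)
Lemma nonpos_iff_cov u : ~ Pos u <-> M u O.
Proof.
split=> [nPu|uO Pu].
- apply: (cov_tra (f := M)) (PosP.1 (fun v => v = u) u erefl) _ => v [[-> //]|Ov].
  exact: cov_ref.
- have [v [[]]] := PosP.2 u (fun=> False) Pu
    (cov_tra uO (fun v Ov => cov_ref M (or_intror Ov))).
Qed.

Lemma closed_sublocale_nonpos :
  same_topology (closed_sublocale M O) (closed_sublocale M (fun u => ~ Pos u)).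
Proof.
move=> a U; split=> aU; apply: (cov_tra (f := M)) aU _ => v [Uv|Ov].
- by apply: cov_ref; left.
- by apply: cov_ref; right; apply/nonpos_iff_cov; exact: cov_ref.
- by apply: cov_ref; left.
- by apply: cov_tra ((nonpos_iff_cov v).1 Ov) _ => w Ow; apply: cov_ref; right.
Qed.

End OvertClosed.

(** * Locatedness of positivity, and points in positive balls *)

Section OvertLocated.
Variables (X : metric_space) (hX : bishop_locally_compact X).
Variables (O Pos : balls X -> Prop).
Let M := localic_completion X.
Hypothesis PosP : positivity (closed_sublocale M O) Pos.
Let Y (x : X) : Prop := is_point (closed_sublocale M O) (j x).

Lemma positivity_located (u v : balls X) : ball_lt v u -> ~ Pos v \/ Pos u.
Proof.
move=> vu; have [v' [vv' v'u]] := ball_lt_dense vu.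
have uW := PosP.1 (fun w => w = u) u erefl.
have [e [e0 He]] := ball_cov_uniform hX.2 uW v'u.
have [n [g [d [d0 ge gc gnear]]]] := finite_net hX.2 vv' e0.
(* Each net ball gives [Pos u] or has all its balls inside [v] covered by [O]. *)
pose Q i := forall c, ball_lt c v -> ball_lt c (g i) -> M c O.
have [i||HQ] := @fin_or _ (Pos u) Q.
- case: (gnear i) => [gi|far]; last by right=> c cv /(far _ cv).
  have [w [[[-> ?]|Ow] gw]] := He _ gi (ge i); first by left.
  right=> c _ cg; apply: cov_tra (cov_ext M (ball_lt_le (ball_lt_trans cg gw))) _.
  by move=> _ ->; exact: cov_ref.
- by right.
left; apply/(nonpos_iff_cov PosP); apply: ball_cov_tra (ball_cov_small v d0) _.
by move=> c [cv /(gc _ cv)[i ci]]; exact: HQ ci.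
Qed.

Lemma pos_le (u v : balls X) : Pos u -> ball_le u v -> Pos v.
Proof.
move=> Pu uv.
by have [_ [-> //]] := positivity_mono PosP Pu (cov_ext M (uv : ple u v)).
Qed.

(** A cover in the closed sublocale may use members of [O], but these are not positive, so no
    neighbourhood of such an [x] is one of them. *)
Lemma closed_pointP (x : X) : Y x <-> forall u, j x u -> Pos u.
Proof.
split=> [[_ _ Yx] u xu|xPos].
- by have [_ [[-> //]]] := Yx u _ xu (PosP.1 (fun w => w = u) u erefl).
- split; [exact: j_inhabited|exact: j_filtering|move=> u W xu uW].
  have [w [[Ww|Ow] xw]] := j_meets_cover hX.2 xu uW; first by exists w.
  by case: ((nonpos_iff_cov PosP w).2 (cov_ref M Ow)); exact: xPos.
Qed.

Lemma pos_ball_has_point (DC : dependent_choice) (u : balls X) :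
  Pos u -> exists y, Y y /\ in_ball u y.
Proof.
move=> Pu; pose T := {v : balls X | Pos v}.
pose R (a b : T) := ball_lt (sval b) (sval a) /\ radius (sval b) <= radius (sval a) / 2.
have total_R a : exists b, R a b.
  case: a => v Pv; have r0 : 0 < radius v / 2 by have := radius_gt0 v; lra.
  have [w [wv Pw]] := positivity_mono PosP Pv (ball_cov_small v r0).
  by exists (exist _ w Pw).
have [f [f0 fR]] := DC T R total_R (exist _ u Pu).
pose s n := sval (f n).
have s_le m k : ball_le (s (m + k)%N) (s m).
  elim: k => [|k IHk]; first by rewrite addn0; exact: ball_le_refl.
  by rewrite addnS; apply: ball_le_trans (ball_lt_le (fR _).1) IHk.
have s_radius n : radius (s n) <= radius u / 2 ^+ n.
  elim: n => [|n IHn]; first by rewrite /s f0 expr0 divr1.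
  apply: le_trans (fR n).2 _; rewrite exprSr invfM mulrA.
  by rewrite ler_pM2r // invr_gt0.
have s_small (e : rat) : 0 < e -> exists n, radius (s n) < e.
  move=> /(exists_half_pow_lt (radius_gt0 u))[n hn].
  by exists n; exact: le_lt_trans hn.
have s_center m n : (m <= n)%N ->
    upper (dist (center (s n)) (center (s m))) (radius (s m)).
  move=> /subnKC <-; apply/xlt_ratE/s_le.
  by have := radius_gt0 (s (m + (n - m))%N); lra.
have [|y sy] := hX.1 (fun n => center (s n)).
  move=> e e0; have e20 : 0 < e / 2 by lra.
  have [N hN] := s_small _ e20; exists N => m n Nm Nn; apply/xlt_ratE.
  have := dist_triangle_upper (s_center _ _ Nm) (dist_sym_upper (s_center _ _ Nn)).
  by apply: dist_upper_le; lra.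
(* The strict inclusion of [s n.+1] in [s n] leaves a margin, so the limit lies in the open ball and
   not merely in its closure. *)
have y_in n : in_ball (s n) y.
  have /ball_ltE/upper_rounded[p [hp cp]] := (fR n).1.
  have d0 : 0 < radius (s n) - radius (s n.+1) - p by rewrite /s; lra.
  have [N HN] := sy _ d0.
  have /xlt_ratE/dist_sym_upper yN := HN _ (leq_maxl N n.+1).
  have := dist_triangle_upper yN (dist_triangle_upper (s_center _ _ (leq_maxr N n.+1)) cp).
  by move=> yn; apply/in_ballE; apply: dist_upper_le yn; rewrite /s; lra.
exists y; split; last by have := y_in 0%N; rewrite /s f0.
apply/closed_pointP => w /in_ballE yw.
have [p [hp cp]] := (upper_rounded _ _).1 yw.
(* Half the slack: the centre of [s n] is within [radius (s n) + p] of that of [w], and [s n] needs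
   its own radius once more. *)
have e0 : 0 < (radius w - p) / 2 by lra.
have [n hn] := s_small _ e0; apply: pos_le (svalP (f n)) _.
apply/ball_lt_le/ball_ltE.
have /in_ballE/dist_sym_upper ny := y_in n.
have nw := dist_triangle_upper ny cp; apply: dist_upper_le nw.
by move: hn; rewrite /s; lra.
Qed.

(** * The distance to [Y] as a cut, and the metric complement *)

Section DistanceCut.
Variable x : X.

(* Every [q < 0] is a lower bound: take [r = 0], for which the condition on
   [r] is vacuous. *)
Let cut_lower (q : rat) :=
  exists r, q < r /\ forall r0 : 0 < r, ~ Pos (B x r0).
Let cut_upper (q : rat) := exists r (r0 : 0 < r), r < q /\ Pos (B x r0).

Fact pos_cut_lower_inhabited : exists q, cut_lower q.
Proof. by exists (-1), 0; split=> // r0; have := r0; rewrite ltxx. Qed.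

Fact pos_cut_lower_rounded q :
  cut_lower q <-> exists r, q < r /\ cut_lower r.
Proof.
split=> [[r [qr nP]]|[r [qr [s [rs nP]]]]].
- by exists ((q + r) / 2); split; [|exists r; split=> //]; lra.
- by exists s; split=> //; exact: lt_trans rs.
Qed.

Fact pos_cut_upper_rounded q :
  cut_upper q <-> exists r, r < q /\ cut_upper r.
Proof.
split=> [[r [r0 [rq P]]]|[r [rq [s [s0 [sr P]]]]]].
- by exists ((q + r) / 2); split; [|exists r, r0; split=> //]; lra.
- by exists s, s0; split=> //; exact: lt_trans rq.
Qed.

Fact pos_cut_disjoint q : ~ (cut_lower q /\ cut_upper q).
Proof.
case=> -[r [qr nP]] [s [s0 [sq P]]].
have r0 : 0 < r by lra.
by apply: (nP r0); apply: pos_le P _; apply/ball_lt_le/concentric_ball_lt; lra.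
Qed.

Fact pos_cut_located q r : q < r -> cut_lower q \/ cut_upper r.
Proof.
move=> qr; case: (ltP q 0) => [q0|q0].
  by left; exists 0; split=> // r0; have := r0; rewrite ltxx.
(* Third points of the interval from [q] to [r], so that both cut conditions hold strictly. *)
have a0 : 0 < (2 * q + r) / 3 by lra.
have b0 : 0 < (q + 2 * r) / 3 by lra.
have /positivity_located[nP|P] : ball_lt (B x a0) (B x b0).
  by apply: concentric_ball_lt; lra.
- left; exists ((2 * q + r) / 3); split=> [|a0']; first by lra.
  by rewrite (bool_irrelevance a0' a0).
- by right; exists ((q + 2 * r) / 3), b0; split=> //; lra.
Qed.

Definition pos_cut : xreal := XReal pos_cut_lower_inhabited
  pos_cut_lower_rounded pos_cut_upper_rounded pos_cut_disjoint pos_cut_located.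

Lemma closed_point_pos y (r : rat) (r0 : 0 < r) :
  Y y -> upper (dist x y) r -> Pos (B x r0).
Proof.
by move=> /closed_pointP Py /dist_sym_upper yr; apply: Py; exact/in_ballE.
Qed.

Lemma pos_cut_is_inf (DC : dependent_choice) : is_inf (distances Y x) pos_cut.
Proof.
split=> [_ [y [Yy ->]] [q [xq [r [qr nP]]]]|b [q [[r [r0 [rq P]]] bq]]].
- have r0 : 0 < r by have := dist_upper_gt0 xq; lra.
  by apply: (nP r0); apply: closed_point_pos Yy _; exact: upper_up xq.
- have [y [Yy /in_ballE/dist_sym_upper/= yr]] := pos_ball_has_point DC P.
  exists (dist x y); split; first by exists y.
  by exists q; split=> //; exact: upper_up yr.
Qed.

Lemma pos_cut_upper_inhabited :
  (exists y, Y y) -> exists q, upper pos_cut q.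
Proof.
case=> y Yy; have [q xq] := upper_inhabited (dist x y).
have q0 := dist_upper_gt0 xq.
exists (q + 1), q, q0; split; first by lra.
exact: closed_point_pos xq.
Qed.

(** Small balls around a point of [O] are not positive, which bounds the distance below; conversely
    a positive distance makes a ball around [x] non-positive, hence covered by [O], and [j x] meets
    that cover. *)
Lemma open_metric_complement (DC : dependent_choice) :
  points_of M O (j x) <-> metric_complement Y x.
Proof.
split=> [[_ [u [xu Ou]]]|[m [[m_lb _] [q [q0 mq]]]]].
- exists pos_cut; split; first exact: pos_cut_is_inf.
  have [d [d0 Hd]] := in_ball_centered xu.
  exists (d / 2); split; first by rewrite /=; lra.
  exists d; split=> [|d0']; first by lra.
  have := (nonpos_iff_cov PosP u).2 (cov_ref M Ou); apply: contra_not => P.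
  by apply: pos_le P _; exact/ball_lt_le/Hd.
- have {}q0 : 0 < q by [].
  have /(nonpos_iff_cov PosP) xO : ~ Pos (B x q0).
    move=> /(pos_ball_has_point DC)[y [Yy /in_ballE/dist_sym_upper/= yq]].
    by apply: (m_lb (dist x y)); [exists y | exists q].
  split; first exact: j_point hX.2 x.
  have xq : in_ball (B x q0) x by apply/in_ballE/dist_refl_upper.
  by have [u [Ou xu]] := j_meets_cover hX.2 xq xO; exists u.
Qed.

End DistanceCut.

End OvertLocated.

Theorem theorem3p4 (DC : dependent_choice) (X : metric_space)
    (hX : bishop_locally_compact X) (O : balls X -> Prop)
    (hO : overt (closed_sublocale (localic_completion X) O)) :
  let M := localic_completion X in
  let Y : X -> Prop := fun x => is_point (closed_sublocale M O) (j x) in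
  formally_located (closed_sublocale M O) /\
  xlocated Y /\
  ((exists y, Y y) -> located Y) /\
  (forall x : X, points_of M O (j x) <-> metric_complement Y x).
Proof.
move=> M Y; have [Pos PosP] := hO.
split; [|split; [|split]].
(* The positivity predicate itself is the located predicate. *)
- exists Pos; split; last exact: closed_sublocale_nonpos.
  split; first exact: positivity_mono PosP.
  by move=> u v; exact: (positivity_located hX PosP).
- by move=> x; exists (pos_cut hX PosP x); exact: pos_cut_is_inf.
- move=> Yne x; exists (DReal (pos_cut_upper_inhabited hX PosP x Yne)).
  exact: pos_cut_is_inf.
- by move=> x; exact: (open_metric_complement hX PosP x DC).
Qed.
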